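(* Let $(X,\mu)$ and $(Y,\lambda)$ be probability spaces with measure-preserving actions of a group $G=\langle S\rangle$. Suppose that there is a $G$-equivariant measurable map $\rho\colon X\to Y$ and a constant $m\in\mathbb{N}$ such that for every measurable $U\subseteq X$, its image $\rho(U)\subseteq Y$ is measurable and $$\frac1m\lambda\big(\rho(U)\big)\leqslant\mu(U)\leqslant\lambda\big(\rho(U)\big).$$ If the action $G\curvearrowright Y$ is expanding in measure and the action $G\curvearrowright X$ is ergodic, then the action $G\curvearrowright X$ is expanding in measure.
   Context: $G$ is a finitely generated group and $S$ is a finite symmetric generating set containing $1_G$. A measure-preserving action of $G$ on a probability space $(X,\mu)$ is expanding in measure if there is $c>0$ such that $\mu\big(\bigcup_{s\in S}s.U\big)\geqslant(1+c)\mu(U)$ for every measurable $U\subseteq X$ with $0<\mu(U)\leqslant\frac12\mu(X)$. It is ergodic if every measurable $U\subseteq X$ with $g.U=U$ for all $g\in G$ satisfies $\mu(U)(\mu(X)-\mu(U))=0$. *)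

(* Defs.v *)
From HB Require Import structures.
From mathcomp Require Import all_boot all_order all_algebra.
From mathcomp Require Import all_classical all_reals all_analysis.

Set Implicit Arguments.
Unset Strict Implicit.
Unset Printing Implicit Defensive.

Import Order.TTheory GRing.Theory Num.Theory.
Import numFieldNormedType.Exports.

Local Open Scope classical_set_scope.
Local Open Scope ring_scope.
Local Open Scope ereal_scope.

(* [groupType] is the library's structure of arbitrary, possibly infinite,
   groups. *)

Definition generates (G : groupType) (S : set G) : Prop :=
  smallest (fun H : set G => group_closed (mem H)) S = setT.

Record finite_symmetric_generating_set (G : groupType) (S : set G) : Prop := {
  fsgs_finite : finite_set S ;
  fsgs_sym : forall s, S s -> S (s^-1)%g ;
  fsgs_one : S 1%g ;
  fsgs_gen : generates S }.

Record measure_preserving_action (G : groupType) (d : measure_display)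
    (X : measurableType d) (R : realType) (mu : probability X R)
    (a : G -> X -> X) : Prop := {
  mpa_one : forall x, a 1%g x = x ;
  mpa_mul : forall g h x, a (g * h)%g x = a g (a h x) ;
  mpa_measurable : forall g, measurable_fun setT (a g) ;
  mpa_preserving : forall g (U : set X),
    measurable U -> mu (a g @^-1` U) = mu U }.

Definition expanding_in_measure (G : groupType) (S : set G)
    (d : measure_display) (X : measurableType d) (R : realType)
    (mu : probability X R) (a : G -> X -> X) : Prop :=
  exists c : R, (0 < c)%R /\
    forall U : set X, measurable U ->
      0 < mu U -> mu U <= (2^-1)%:E * mu setT ->
      (1 + c)%:E * mu U <= mu (\bigcup_(s in S) (a s @` U)).

Definition ergodic (G : groupType) (d : measure_display)
    (X : measurableType d) (R : realType) (mu : probability X R)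
    (a : G -> X -> X) : Prop :=
  forall U : set X, measurable U -> (forall g, a g @` U = U) ->
    mu U * (mu setT - mu U) = 0.

Definition equivariant (G : groupType) (X Y : Type)
    (aX : G -> X -> X) (aY : G -> Y -> Y) (rho : X -> Y) : Prop :=
  forall g x, rho (aX g x) = aY g (rho x).

(* Main.v *)
(* Call [mu (S U \ U)] the leak of [U].  Through [rho], the expansion of [Y]
   shows that a set of small leak in [X] has measure either close to [0] or at
   least [r = 1 / (2 m)], while a failure of expansion in [X] yields sets of
   arbitrarily small leak with measure in [[r, 1/2]].  By Borel-Cantelli the
   liminf of sets with summable leaks is almost invariant, hence null by
   ergodicity when all of them have measure at most [1/2]; so no sequence of
   such sets has finite intersections all of measure at least [r].  Hence there
   are sets of small leak that meet every set of much smaller leak in measure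
   less than [r], and so, by the dichotomy, in measure close to [0].  Collecting
   more than [2 / r] of them, almost disjoint, exceeds total measure [1]. *)
Require Import Defs.
From mathcomp Require Import all_boot all_order all_algebra.
From mathcomp Require Import all_classical all_reals all_analysis.
From mathcomp Require Import ring lra.

Import Order.TTheory GRing.Theory Num.Theory.
Import numFieldNormedType.Exports.

Local Open Scope classical_set_scope.
Local Open Scope ring_scope.
Local Open Scope ereal_scope.

(** * Real-valued form of a probability measure *)

Section real_probability.
Context {d : measure_display} {X : measurableType d} {R : realType}.
Variable mu : probability X R.
Implicit Types A B : set X.

Definition prob A : R := fine (mu A).

Local Notation pr := prob.

Lemma prE A : measurable A -> mu A = (pr A)%:E.
Proof. by move=> mA; rewrite /prob fineK// fin_num_measure. Qed.

Lemma pr_ge0 A : (0 <= pr A)%R.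
Proof. exact: fine_ge0. Qed.

Lemma pr_le1 A : measurable A -> (pr A <= 1)%R.
Proof. by move=> mA; rewrite -lee_fin -prE// probability_le1. Qed.

Lemma le_pr A B : measurable A -> measurable B -> A `<=` B ->
  (pr A <= pr B)%R.
Proof. by move=> mA mB AB; rewrite -lee_fin -!prE// le_measure// inE. Qed.

Lemma prDI A B : measurable A -> measurable B ->
  pr A = (pr (A `\` B) + pr (A `&` B))%R.
Proof.
move=> mA mB; apply: EFin_inj; rewrite EFinD -!prE//.
- exact: measureDI.
- exact: measurableI.
- exact: measurableD.
Qed.

Lemma le_prU A B : measurable A -> measurable B ->
  (pr (A `|` B) <= pr A + pr B)%R.
Proof.
move=> mA mB; rewrite -lee_fin EFinD -!prE ?measureU2//.
exact: measurableU.
Qed.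

Lemma prU A B : measurable A -> measurable B ->
  (pr (A `|` B) = pr A + pr B - pr (A `&` B))%R.
Proof.
move=> mA mB; have mAB := measurableU _ _ mA mB.
apply: EFin_inj; rewrite EFinB EFinD -!prE//; last exact: measurableI.
by rewrite measureUfinr//; rewrite -ge0_fin_numE// fin_num_measure.
Qed.

End real_probability.

(** * Spread [S U] of a set and its leak *)

Section approximately_invariant_sets.
Context {R : realType} {G : groupType} {S : set G}.
Hypothesis HS : finite_symmetric_generating_set S.
Context {d : measure_display} {X : measurableType d}.
Variables (mu : probability X R) (a : G -> X -> X).
Hypothesis Ha : measure_preserving_action mu a.
Implicit Types U V : set X.

Local Notation pr := (prob mu).

Definition spread U : set X := \bigcup_(s in S) (a s @` U).

Definition leak U : R := pr (spread U `\` U).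

Lemma action_imageE g U : a g @` U = a (g^-1)%g @^-1` U.
Proof.
apply/seteqP; split=> [_ [x Ux <-]|x Ux] /=.
  by rewrite -(mpa_mul Ha) mulVg (mpa_one Ha).
by exists (a (g^-1)%g x) => //; rewrite -(mpa_mul Ha) mulgV (mpa_one Ha).
Qed.

Lemma measurable_action_image g U : measurable U -> measurable (a g @` U).
Proof.
move=> mU; rewrite action_imageE -[X in measurable X]setTI.
exact: (mpa_measurable Ha).
Qed.

Lemma mu_action_image g U : measurable U -> mu (a g @` U) = mu U.
Proof. by move=> mU; rewrite action_imageE (mpa_preserving Ha). Qed.

Lemma measurable_spread U : measurable U -> measurable (spread U).
Proof.
move=> mU; apply: fin_bigcup_measurable; first exact: fsgs_finite HS.
by move=> s _; exact: measurable_action_image.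
Qed.

Lemma measurable_leak U : measurable U -> measurable (spread U `\` U).
Proof. by move=> mU; apply: measurableD => //; exact: measurable_spread. Qed.

Lemma sub_spread U : U `<=` spread U.
Proof.
move=> x Ux; exists 1%g; first exact: fsgs_one HS.
by exists x => //; rewrite (mpa_one Ha).
Qed.

Lemma pr_spread U : measurable U -> pr (spread U) = (pr U + leak U)%R.
Proof.
move=> mU; rewrite (prDI mu (spread U) U)//; last exact: measurable_spread.
by rewrite (setIidr (sub_spread _)) addrC.
Qed.

(** A translate of a point of [U] and [V] that leaves the intersection leaves [U] or leaves [V]. *)
Lemma leakI U V : measurable U -> measurable V ->
  (leak (U `&` V) <= leak U + leak V)%R.
Proof.
move=> mU mV; apply: le_trans (le_prU mu _ _ _ _); try exact: measurable_leak.
apply: le_pr; [|by apply: measurableU; exact: measurable_leak|].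
  by apply: measurable_leak; exact: measurableI.
move=> x [[s Ss [y [Uy Vy] <-]] nUV].
have [Ux|nU] := pselect (U (a s y)); last first.
  by left; split => //; exists s => //; exists y.
by right; split; [exists s => //; exists y|move=> Vx; apply: nUV].
Qed.

Lemma spread_null U : measurable U -> mu U = 0 -> mu (spread U) = 0.
Proof.
move=> mU U0; apply: measure_negligible; first exact: measurable_spread.
have /finite_seqP[s sE] := fsgs_finite HS.
rewrite /spread sE bigcup_seq.
elim: s {sE} => [|g s IH]; first by rewrite big_nil; exact: negligible_set0.
rewrite big_cons; apply: negligibleU => //.
apply/negligibleP; first exact: measurable_action_image.
by rewrite -U0; exact: mu_action_image.
Qed.

(** Induction on [n]: what leaks from [S V] is a translate of what leaks from [V], and translates of
    null sets by the finite set [S] are null. *)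
Lemma spread_iter_leak U n : measurable U -> mu (spread U `\` U) = 0 ->
  [/\ measurable (iter n spread U), U `<=` iter n spread U,
      mu (iter n spread U `\` U) = 0 &
      mu (spread (iter n spread U) `\` iter n spread U) = 0].
Proof.
move=> mU U0; elim: n => [|n [mn Un n0 s0]].
  by split => //=; rewrite setDv measure0.
have mSn := measurable_spread _ mn; have mDn := measurable_leak _ mn.
split => //=.
- exact: subset_trans Un (sub_spread _).
- apply: (subset_measure0 (B := (spread (iter n spread U) `\` iter n spread U)
      `|` (iter n spread U `\` U))).
  + exact: measurableD.
  + by apply: measurableU => //; exact: measurableD.
  + by move=> x [? ?]; have [?|?] := pselect (iter n spread U x); [right|left].
  + by apply: null_set_setU => //; exact: measurableD.
- apply: (subset_measure0
      (B := spread (spread (iter n spread U) `\` iter n spread U))).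
  + exact: measurable_leak.
  + exact: measurable_spread.
  + move=> x [[s Ss [y Sy <-]] nS]; exists s => //; exists y => //; split => //.
    by move=> ny; apply: nS; exists s => //; exists y.
  + exact: spread_null.
Qed.

Lemma spread_closed_invariant U : spread U `<=` U -> forall g, a g @` U = U.
Proof.
move=> SU.
have sU s x : S s -> U x -> U (a s x).
  by move=> Ss Ux; apply: SU; exists s => //; exists x.
(* The equivalence makes [H] a subgroup. It contains [S] because [S] is symmetric, so it is all of
   [G]. *)
pose H : set G := [set g | forall x, U (a g x) <-> U x].
have H1 g : H g.
  have : smallest (fun K : set G => group_closed (mem K)) S g.
    by rewrite (fsgs_gen HS).
  apply: smallest_sub.
    split; first by rewrite inE => x; rewrite (mpa_one Ha).
    move=> u v; rewrite !inE => Hu Hv x.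
    rewrite (mpa_mul Ha) (Hu _) -(Hv _) -(mpa_mul Ha) mulgV (mpa_one Ha).
    by [].
  move=> s Ss x; split=> [Usx|]; last exact: sU.
  have := sU _ _ (fsgs_sym HS Ss) Usx.
  by rewrite -(mpa_mul Ha) mulVg (mpa_one Ha).
move=> g; rewrite action_imageE; apply/seteqP.
by split=> x /=; rewrite (H1 (g^-1)%g x).
Qed.

(** * Ergodicity and limits of sets of small leak *)

Hypothesis Herg : ergodic mu a.

Lemma ergodic_leak0 U : measurable U -> leak U = 0%R -> (pr U <= 2^-1)%R ->
  pr U = 0%R.
Proof.
move=> mU lU0 U12.
have mSU := measurable_leak _ mU.
have U0 : mu (spread U `\` U) = 0 by rewrite prE// [pr _]lU0.
have HU n := spread_iter_leak U n mU U0.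
(* [V] is invariant and differs from [U] by a null set, so ergodicity gives [U] measure 0 or 1. *)
pose V := \bigcup_n iter n spread U.
have mV : measurable V by apply: bigcupT_measurable => n; have [] := HU n.
have UV : U `<=` V by move=> x Ux; exists 0%N.
have VU0 : mu (V `\` U) = 0.
  apply: measure_negligible; first exact: measurableD.
  rewrite setD_bigcupl; apply: negligible_bigcup => n.
  by apply/negligibleP; [apply: measurableD|]; have [] := HU n.
have prVU : pr V = pr U.
  by rewrite (prDI mu V U)// (setIidr UV) /prob VU0 add0r.
have invV : forall g, a g @` V = V.
  apply: spread_closed_invariant => x [s Ss [y [n _ yn] <-]].
  by exists n.+1 => //=; exists s => //; exists y.
have := Herg _ mV invV.
rewrite probability_setT prE// prVU -EFinB -EFinM => e.
have {e} /eqP : (pr U * (1 - pr U) = 0)%R := EFin_inj e.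
by rewrite mulf_eq0 => /orP[/eqP ->//|/eqP]; lra.
Qed.


(** A point leaking from the liminf comes from a point lying in all late [F n], yet misses
    infinitely many [F n]. It thus lies in infinitely many leaks, and these have total measure at
    most [e]: Borel-Cantelli applies. *)
Lemma leak_liminf (F : nat -> set X) (e : R) : (0 <= e)%R ->
  (forall n, measurable (F n)) ->
  (forall n, leak (F n) <= e / (2 ^ n.+1)%:R)%R ->
  leak (\bigcup_k \bigcap_(n in [set n | (k <= n)%N]) F n) = 0%R.
Proof.
move=> e0 mF leF; set L := \bigcup_k _.
have mL : measurable L.
  by apply: bigcupT_measurable => k; apply: bigcap_measurableType.
have mlF n := measurable_leak _ (mF n).
suff : mu (spread L `\` L) = 0 by rewrite /leak /prob => ->.
have ls0 : mu (lim_sup_set (fun n => spread (F n) `\` F n)) = 0.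
  apply: lim_sup_set_cvg0 => //.
  apply: (@le_lt_trans _ _ e%:E); last exact: ltry.
  apply: le_trans (epsilon_trick0 xpredT e0).
  apply: lee_nneseries => // n _.
  by rewrite /= prE// lee_fin; exact: leF.
apply: subset_measure0 ls0; first exact: measurable_leak.
  by apply: bigcap_measurableType => // k _; exact: bigcup_measurable.
move=> x [[s Ss [y [k _ Fy] <-]] nLx] k' _.
apply: contrapT => nj; apply: nLx; exists (maxn k k') => // n /= kn.
apply: contrapT => nFn; apply: nj.
exists n => /=; first by rewrite (leq_trans _ kn)// leq_maxr.
split => //; exists s => //; exists y => //; apply: Fy => /=.
by rewrite (leq_trans _ kn)// leq_maxl.
Qed.

Lemma le_pr_bigcap (F : nat -> set X) (r : R) :
  (forall n, measurable (F n)) -> (forall n, F n.+1 `<=` F n) ->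
  (forall n, r <= pr (F n))%R -> (r <= pr (\bigcap_n F n))%R.
Proof.
move=> mF dF rF; have mI := bigcapT_measurable mF.
rewrite -lee_fin -prE//.
have F0 : mu (F 0%N) < +oo by rewrite prE// ltry.
have niF : nonincreasing_seq F.
  by apply/nonincreasing_seqP => n; apply/subsetPset; exact: dF.
apply: (cvge_to_ge (@nonincreasing_cvg_mu _ _ _ mu F F0 mF mI niF)).
by apply: nearW => n /=; rewrite prE// lee_fin.
Qed.

Lemma pr_bigcup_le (F : nat -> set X) (r : R) :
  (forall n, measurable (F n)) -> (forall n, F n `<=` F n.+1) ->
  (forall n, pr (F n) <= r)%R -> (pr (\bigcup_n F n) <= r)%R.
Proof.
move=> mF dF rF; have mU := bigcupT_measurable _ mF.
rewrite -lee_fin -prE//.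
have ndF : nondecreasing_seq F.
  by apply/nondecreasing_seqP => n; apply/subsetPset; exact: dF.
apply: (cvge_to_le (@nondecreasing_cvg_mu _ _ _ mu F mF mU ndF)).
by apply: nearW => n /=; rewrite prE// lee_fin.
Qed.

(** The liminf of [F] has null leak and measure at most 1/2, hence is null; but it contains the
    intersection of the [W n]. *)
Lemma no_persistent_intersection (F W : nat -> set X) (r e : R) :
  (0 <= e)%R -> (0 < r)%R ->
  (forall n, measurable (F n)) -> (forall n, measurable (W n)) ->
  (forall n, leak (F n) <= e / (2 ^ n.+1)%:R)%R ->
  (forall n, pr (F n) <= 2^-1)%R ->
  (forall n, W n.+1 `<=` F n `&` W n) ->
  ~ (forall n, r <= pr (W n))%R.
Proof.
move=> e0 r0 mF mW leF F12 WF rW.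
have mT k : measurable (\bigcap_(n in [set n | (k <= n)%N]) F n).
  exact: bigcap_measurableType.
have mL := bigcupT_measurable _ mT.
have L0 := leak_liminf _ _ e0 mF leF.
have L12 : (pr (\bigcup_k \bigcap_(n in [set n | (k <= n)%N]) F n) <= 2^-1)%R.
  apply: pr_bigcup_le => // k.
    by move=> x Fx n /= kn; apply: Fx => /=; exact: ltnW.
  by apply: le_trans (F12 k); apply: le_pr => // x; apply => /=.
have dW n : W n.+1 `<=` W n by apply: subset_trans (WF n) _; exact: subIsetr.
have rL := le_pr_bigcap _ _ mW dW rW.
have := le_pr mu _ _ (bigcapT_measurable mW) mL.
rewrite (ergodic_leak0 _ mL L0 L12) => /(_ _)/(le_trans rL).
rewrite leNgt r0 => H; suff: false by []; apply: H.
by move=> x Wx; exists 0%N => // n _; have [] := WF n x (Wx n.+1 I).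
Qed.

(** * Packing sets of small leak and measure at least [r] *)

Definition nearly_invariant (r e : R) U :=
  [/\ measurable U, leak U <= e, r <= pr U & pr U <= 2^-1]%R.

Lemma exists_eventually_separated (r e : R) : (0 < r)%R -> (0 < e)%R ->
  (forall e' : R, (0 < e')%R -> exists U, nearly_invariant r e' U) ->
  exists W, nearly_invariant r e W /\ exists2 e' : R, (0 < e')%R &
    forall U, nearly_invariant r e' U -> (pr (U `&` W) < r)%R.
Proof.
move=> r0 e0 exU; apply: contrapT => noW.
(* Without a separated set, every nearly invariant [W] admits partners of arbitrarily small leak
   meeting it in measure at least [r]. *)
have /choice[f fP] : forall p : set X * R, exists U,
    nearly_invariant r e p.1 -> (0 < p.2)%R ->
    nearly_invariant r p.2 U /\ (r <= pr (U `&` p.1))%R.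
  move=> [W e'] /=; apply: contrapT => noU; apply: noW.
  have [W1 e'0] : nearly_invariant r e W /\ (0 < e')%R.
    by split; apply: contrapT => H; apply: noU; exists W => // *; case: H.
  exists W; split => //; exists e' => // U HU; rewrite ltNge; apply/negP => rU.
  by apply: noU; exists U.
have e20 : (0 < e / 2)%R by rewrite divr_gt0.
have [W0 W0P] := exU _ e20.
(* Leak budget: [W0] uses [e / 2] and the n-th intersection adds at most [dl n], which leaves
   [2 * dl n] unspent at [W n]. *)
pose dl n : R := (e / 2 / (2 ^ n.+1)%:R)%R.
have dl0 n : (0 < dl n)%R by rewrite divr_gt0// ltr0n expn_gt0.
have dlS n : dl n = (2 * dl n.+1)%R.
  by rewrite /dl (expnS 2 n.+1) natrM invfM; field; rewrite pnatr_eq0 expn_eq0.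
pose W := fix W n := if n is k.+1 then f (W k, dl k) `&` W k else W0.
have WP n : nearly_invariant r (e - 2 * dl n)%R (W n).
  elim: n => [|n IH].
    have -> : (e - 2 * dl 0 = e / 2)%R by rewrite /dl expn1; field.
    exact: W0P.
  have Wn : nearly_invariant r e (W n).
    case: IH => mW lW rW W12; split => //; apply: (le_trans lW).
    by have := dl0 n; lra.
  have [[mU lU rU U12] rUW] := fP (W n, dl n) Wn (dl0 n).
  case: IH => mW lW rW W12 /=; split => //.
  - exact: measurableI.
  - apply: le_trans (leakI _ _ mU mW) _; rewrite /= in lU.
    by have := dlS n; lra.
  - apply: le_trans W12; apply: le_pr => //; first exact: measurableI.
have Wn n : nearly_invariant r e (W n).
  have [mW lW rW W12] := WP n; split => //; apply: (le_trans lW).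
  by have := dl0 n; lra.
pose F n := f (W n, dl n).
have FP n := fP (W n, dl n) (Wn n) (dl0 n).
apply: (@no_persistent_intersection F W r (e / 2)) => //.
- exact: ltW.
- by move=> n; have [[]] := FP n.
- by move=> n; have [] := Wn n.
- by move=> n; have [[]] := FP n.
- by move=> n; have [[]] := FP n.
- by move=> n x.
- by move=> n; have [] := Wn n.
Qed.

Lemma ergodic_gap_expanding (r c : R) : (0 < r)%R -> (0 < c)%R ->
  (forall U, measurable U -> (r <= pr U)%R \/ (c * pr U <= leak U)%R) ->
  expanding_in_measure S mu a.
Proof.
move=> r0 c0 gap; apply: contrapT => nexp.
have exU (e : R) : (0 < e)%R -> exists U, nearly_invariant r e U.
  move=> e0; apply: contrapT => noU; apply: nexp.
  (* The bound [e] makes the leak small; [c / 2] rules out the second alternative of [gap]. *)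
  exists (Num.min e (c / 2))%R; split; first by rewrite lt_min e0 divr_gt0.
  move=> U mU; rewrite probability_setT mule1 prE// lte_fin lee_fin => U0 U12.
  rewrite -/(spread U) prE; last exact: measurable_spread.
  rewrite -EFinM lee_fin pr_spread// mulrDl mul1r lerD2l leNgt.
  apply/negP => lU.
  have min_e : (Num.min e (c / 2) <= e)%R by rewrite ge_min lexx.
  have min_c : (Num.min e (c / 2) <= c / 2)%R by rewrite ge_min lexx orbT.
  apply: noU; exists U; split => //.
    apply: le_trans (ltW lU) _; apply: le_trans (ler_wpM2r (ltW U0) min_e) _.
    by rewrite ler_piMr ?pr_le1// ltW.
  have [//|] := gap _ mU => cU.
  by have := ler_wpM2r (ltW U0) min_c; nra.
(* [D] is a union of [k] sets, each adding at least [r / 2]. Having every [h] available in the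
   induction keeps the next set almost disjoint from [D]. *)
have pack (k : nat) : forall h : R, (0 < h)%R -> exists D,
    [/\ measurable D, (k%:R * (r / 2) <= pr D)%R & exists2 e : R, (0 < e)%R &
      forall U, nearly_invariant r e U -> (pr (U `&` D) <= h)%R].
  elim: k => [h h0|k IH h h0].
    exists set0; split => //; first by rewrite mul0r pr_ge0.
    by exists 1%R => // U _; rewrite setI0 /prob measure0 ltW.
  (* [r / 2] lets the new set [W] add at least [r / 2]; [h / 2] leaves the other half of [h] for the
     overlap with [W]. *)
  pose h' := (Num.min (h / 2) (r / 2))%R.
  have h'0 : (0 < h')%R by rewrite lt_min !divr_gt0.
  have [D [mD kD [e e0 eD]]] := IH _ h'0.
  (* The intersection of [U] and [W] will leak at most [2 * e1], so [gap] bounds its measure by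
     [h / 2]. *)
  pose e1 := (Num.min e (c * h / 4))%R.
  have e10 : (0 < e1)%R by rewrite lt_min e0 divr_gt0// mulr_gt0.
  have e1e : (e1 <= e)%R by rewrite ge_min lexx.
  have e1c : (e1 <= c * h / 4)%R by rewrite ge_min lexx orbT.
  have h'h : (h' <= h / 2)%R by rewrite ge_min lexx.
  have h'r : (h' <= r / 2)%R by rewrite ge_min lexx orbT.
  have [W [[mW lW rW W12] [e' e'0 sepW]]] :=
    exists_eventually_separated _ _ r0 e10 exU.
  exists (D `|` W); split; first exact: measurableU.
    have WD : (pr (W `&` D) <= h')%R.
      by apply: eD; split => //; exact: le_trans e1e.
    rewrite prU// setIC -natr1 mulrDl; lra.
  exists (Num.min e' e1)%R; first by rewrite lt_min e'0.
  move=> U [mU lU rU U12].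
  have UD : (pr (U `&` D) <= h')%R.
    apply: eD; split => //; apply: le_trans lU _; apply: le_trans e1e.
    by rewrite ge_min lexx orbT.
  have UW : (pr (U `&` W) < r)%R.
    by apply: sepW; split => //; apply: le_trans lU _; rewrite ge_min lexx.
  have lUe : (leak U <= e1)%R by apply: le_trans lU _; rewrite ge_min lexx orbT.
  have mUW := measurableI _ _ mU mW; have mUD := measurableI _ _ mU mD.
  have UWh : (pr (U `&` W) <= h / 2)%R.
    have [|cUW] := gap _ mUW; first by rewrite leNgt UW.
    rewrite -(ler_pM2l c0); apply: le_trans cUW _.
    by apply: le_trans (leakI _ _ mU mW) _; lra.
  rewrite setIUr; apply: le_trans (le_prU _ _ _ mUD mUW) _; lra.
(* More than [2 / r] sets give [D] measure above 1. *)
have [D [mD kD _]] := pack (Num.bound (2 / r)%R) 1%R ltr01.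
have := @archi_boundP R (2 / r)%R; rewrite divr_ge0 ?ltW// => /(_ isT).
rewrite ltr_pdivrMr// => rk.
by have := pr_le1 mu D mD; nra.
Qed.

End approximately_invariant_sets.

Arguments spread {G} S {d X} a U.
Arguments leak {R G} S {d X} mu a U.

(** * Transfer of expansion through [rho] *)

Theorem proposition3p1 (R : realType) (G : groupType) (S : set G)
  (HS : finite_symmetric_generating_set S)
  (dX dY : measure_display) (X : measurableType dX) (Y : measurableType dY)
  (mu : probability X R) (lambda : probability Y R)
  (aX : G -> X -> X) (aY : G -> Y -> Y)
  (HaX : measure_preserving_action mu aX)
  (HaY : measure_preserving_action lambda aY)
  (rho : X -> Y) (m : nat)
  (rho_equiv : equivariant aX aY rho)
  (rho_meas : measurable_fun setT rho)
  (m_gt0 : (0 < m)%N)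
  (rho_image : forall U : set X, measurable U ->
     measurable (rho @` U) /\
     (m%:R^-1)%:E * lambda (rho @` U) <= mu U /\
     mu U <= lambda (rho @` U))
  (Yexp : expanding_in_measure S lambda aY)
  (Xerg : ergodic mu aX) :
  expanding_in_measure S mu aX.
Proof.
have m0 : (0 < m%:R :> R)%R by rewrite ltr0n.
have [c [c0 Yc]] := Yexp.
apply: (ergodic_gap_expanding HS _ _ HaX Xerg (2^-1 / m%:R)%R (c / m%:R)%R).
- by rewrite divr_gt0.
- by rewrite divr_gt0.
move=> U mU.
have [mV [Vm UV]] := rho_image U mU.
have mD := measurable_leak HS _ _ HaX _ mU.
have [mrD [rDm _]] := rho_image _ mD.
move: Vm UV rDm; rewrite !prE// -!EFinM !lee_fin => Vm UV rDm.
(* An image larger than 1/2 forces [U] to have measure at least [1 / (2 m)]; otherwise the expansion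
   of [Y] applies to the image. *)
have [V12|V12] := leP (prob lambda (rho @` U)) 2^-1%R; last first.
  by left; apply: le_trans Vm; rewrite mulrC ler_pM2l ?invr_gt0// ltW.
right.
have lV : (c * prob lambda (rho @` U) <= leak S lambda aY (rho @` U))%R.
  have [V0|V0] := leP (prob lambda (rho @` U)) 0%R.
    by rewrite (le_trans _ (pr_ge0 _ _))// pmulr_rle0.
  have := Yc _ mV; rewrite probability_setT mule1 prE// lte_fin lee_fin.
  move=> /(_ V0 V12); rewrite -/(spread _ _ _) prE; last first.
    exact: (measurable_spread HS lambda aY HaY).
  rewrite -EFinM lee_fin (pr_spread HS lambda aY HaY)//; lra.
(* By equivariance, a point leaking from the image of [U] is the image of a point leaking from
   [U]. *)
have sub : spread S aY (rho @` U) `\` rho @` U `<=`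
    rho @` (spread S aX U `\` U).
  move=> _ [[s Ss [_ [x Ux <-] <-]] nV]; rewrite -rho_equiv in nV *.
  exists (aX s x) => //; split; first by exists s => //; exists x.
  by move=> sU; apply: nV; exists (aX s x).
have mlV := measurable_leak HS lambda aY HaY _ mV.
have := le_pr lambda _ _ mlV mrD sub.
have im0 : (0 < m%:R^-1 :> R)%R by rewrite invr_gt0.
rewrite -[prob _ _]/(leak S lambda aY (rho @` U)) => lVD.
(* The factor [1 / m] is lost in passing from the image of the leak back to the leak. *)
apply: le_trans rDm; rewrite [(c / _)%R]mulrC -mulrA ler_pM2l//.
by apply: le_trans lVD; apply: le_trans lV; rewrite ler_pM2l.
Qed.
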